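(* Let $F$ be a formally real, non-pythagorean field, and suppose $F$ has a supreme torsion form $\pi$ which is an $n$-fold Pfister form for some $n\in\mathbb N$. Then the height satisfies $h(F)\leq 2^n$. Moreover, $h(F)=2^n$ if and only if $2^{n-1}\times\langle 1\rangle$ (the orthogonal sum of $2^{n-1}$ copies of $\langle1\rangle$) is a subform of $\pi$.
   Context: Quadratic forms are nondegenerate and finite-dimensional; forms are identified up to isometry. A form over $F$ is called torsion if its Witt class lies in the torsion subgroup $W_tF$ of the Witt ring $WF$. A supreme torsion form over $F$ is an anisotropic torsion form $\varphi$ such that every anisotropic torsion form over $F$ is similar to a subform of $\varphi$. An $n$-fold Pfister form is a form $\langle\langle a_1,\dots,a_n\rangle\rangle:=\langle1,-a_1\rangle\otimes\cdots\otimes\langle1,-a_n\rangle$ with $a_i\in F^\ast$. The height $h(F)$ is the exponent of the group $W_tF$ (or $\infty$ if it has no finite exponent). A field is pythagorean if every sum of squares is a square. *)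

(* Defs.v *)
From HB Require Import structures.
From mathcomp Require Import all_boot all_order all_algebra.
From mathcomp Require Import generic_quotient.
From mathcomp Require Import mxtens.
From mathcomp Require Import boolp.

Set Implicit Arguments.
Unset Strict Implicit.
Unset Printing Implicit Defensive.

Import GRing.Theory.
Local Open Scope ring_scope.
Local Open Scope quotient_scope.

Section Fields.
Variable F : fieldType.

Definition sum_of_squares (x : F) : Prop :=
  exists s : seq F, x = \sum_(y <- s) y ^+ 2.

Definition formally_real : Prop := ~ sum_of_squares (-1).

Definition pythagorean : Prop :=
  forall x : F, sum_of_squares x -> exists y : F, x = y ^+ 2.

Definition nonzero : Type := {a : F | a != 0}.

Definition nz1 : nonzero :=
  exist (fun x : F => x != 0) 1 (oner_neq0 F).

Lemma nzN_subproof (a : nonzero) : - sval a != 0.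
Proof. by rewrite oppr_eq0; exact: (svalP a). Qed.

Definition nzN (a : nonzero) : nonzero :=
  exist (fun x : F => x != 0) (- sval a) (nzN_subproof a).

End Fields.

(* A nondegenerate quadratic form on F^n, given by its Gram matrix.  Only used *)
(* when 2 != 0 in F, in which case quadratic forms and symmetric bilinear      *)
(* forms are the same thing.  Dimension 0 is allowed.                          *)
Record qform (F : fieldType) : Type := QForm {
  qdim : nat;
  gram : 'M[F]_qdim;
  gram_sym : gram^T = gram;
  gram_unit : gram \in unitmx
}.

HB.instance Definition _ (F : fieldType) := gen_eqMixin (qform F).
HB.instance Definition _ (F : fieldType) := gen_choiceMixin (qform F).

Section QuadraticForms.
Variable F : fieldType.
Implicit Types phi psi : qform F.

Definition qval phi (v : 'rV[F]_(qdim phi)) : F := (v *m gram phi *m v^T) 0 0.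

Definition isometric phi psi : Prop :=
  exists f : 'rV[F]_(qdim phi) -> 'rV[F]_(qdim psi),
    [/\ linear f, bijective f & forall v, qval (f v) = qval v].

Definition anisotropic phi : Prop :=
  forall v : 'rV[F]_(qdim phi), qval v = 0 -> v = 0.

Lemma qzero_sym : (0 : 'M[F]_0)^T = 0.
Proof. exact: trmx0. Qed.

Lemma qzero_unit : (0 : 'M[F]_0) \in unitmx.
Proof. by rewrite unitmxE det_mx00 unitr1. Qed.

Definition qzero : qform F := QForm qzero_sym qzero_unit.

Lemma qline_sym (a : nonzero F) : ((sval a)%:M : 'M[F]_1)^T = (sval a)%:M.
Proof. exact: tr_scalar_mx. Qed.

Lemma qline_unit (a : nonzero F) : ((sval a)%:M : 'M[F]_1) \in unitmx.
Proof. by rewrite unitmxE det_scalar expr1 unitfE; exact: (svalP a). Qed.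

Definition qline (a : nonzero F) : qform F := QForm (qline_sym a) (qline_unit a).

Lemma qsum_sym phi psi :
  (block_mx (gram phi) 0 0 (gram psi))^T = block_mx (gram phi) 0 0 (gram psi).
Proof. by rewrite tr_block_mx !trmx0 !gram_sym. Qed.

Lemma qsum_unit phi psi : block_mx (gram phi) 0 0 (gram psi) \in unitmx.
Proof.
by rewrite unitmxE det_ublock unitrM -!unitmxE !gram_unit.
Qed.

Definition qsum phi psi : qform F := QForm (qsum_sym phi psi) (qsum_unit phi psi).

Lemma qtens_sym phi psi :
  (tensmx (gram phi) (gram psi))^T = tensmx (gram phi) (gram psi).
Proof. by rewrite trmx_tens !gram_sym. Qed.

Lemma qtens_unit phi psi : tensmx (gram phi) (gram psi) \in unitmx.
Proof.
suff : tensmx (invmx (gram phi)) (invmx (gram psi)) *m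
       tensmx (gram phi) (gram psi) = 1%:M by case/mulmx1_unit.
rewrite tensmx_mul !mulVmx ?gram_unit //; apply/matrixP => i j.
case: (mxtens_indexP i) => i1 i2; case: (mxtens_indexP j) => j1 j2.
rewrite tensmxE !mxE (inj_eq (can_inj (@mxtens_indexK _ _))) xpair_eqE.
by rewrite -natrM mulnb.
Qed.

Definition qtens phi psi : qform F := QForm (qtens_sym phi psi) (qtens_unit phi psi).

Lemma qscale_sym (c : nonzero F) phi : (sval c *: gram phi)^T = sval c *: gram phi.
Proof. by rewrite linearZ /= gram_sym. Qed.

Lemma qscale_unit (c : nonzero F) phi : sval c *: gram phi \in unitmx.
Proof.
by rewrite unitmxZ ?gram_unit // unitfE; exact: (svalP c).
Qed.

Definition qscale (c : nonzero F) phi : qform F :=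
  QForm (qscale_sym c phi) (qscale_unit c phi).

(* k x phi, the orthogonal sum of k copies of phi. *)
Definition qmuln (k : nat) phi : qform F := iter k (qsum phi) qzero.

Definition similar phi psi : Prop :=
  exists c : nonzero F, isometric phi (qscale c psi).

Definition subform phi psi : Prop :=
  exists chi : qform F, isometric psi (qsum phi chi).

Definition qpfister (s : seq (nonzero F)) : qform F :=
  foldr (fun a phi => qtens (qsum (qline (nz1 F)) (qline (nzN a))) phi)
        (qline (nz1 F)) s.

Definition pfister (n : nat) phi : Prop :=
  exists s : n.-tuple (nonzero F), isometric phi (qpfister s).

Definition hyperbolic_plane : qform F :=
  qsum (qline (nz1 F)) (qline (nzN (nz1 F))).

Definition witt_equiv phi psi : Prop :=
  exists i j : nat,
    isometric (qsum phi (qmuln i hyperbolic_plane))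
              (qsum psi (qmuln j hyperbolic_plane)).

End QuadraticForms.

Section IsometryTheory.
Variable F : fieldType.
Implicit Types phi psi chi : qform F.

Lemma isometric_refl phi : isometric phi phi.
Proof. by exists id; split=> //; exists id. Qed.

Lemma isometric_sym phi psi : isometric phi psi -> isometric psi phi.
Proof.
case=> f [lf [g fK gK] qf]; exists g; split; last by move=> v; rewrite -qf gK.
  by move=> a u v; apply: (can_inj fK); rewrite lf !gK.
by exists f.
Qed.

Lemma isometric_trans psi phi chi :
  isometric phi psi -> isometric psi chi -> isometric phi chi.
Proof.
case=> f [lf bf qf] [g [lg bg qg]]; exists (g \o f); split.
- by move=> a u v; rewrite /= lf lg.
- exact: bij_comp.
- by move=> v; rewrite /= qg qf.
Qed.

Lemma qval_qsum phi psi (v : 'rV[F]_(qdim phi + qdim psi)) :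
  @qval F (qsum phi psi) v =
  @qval F phi (lsubmx v) + @qval F psi (rsubmx v).
Proof.
rewrite /qval /= -{1 2}[v]hsubmxK mul_row_block !mulmx0 addr0 add0r.
by rewrite tr_row_mx mul_row_col mxE.
Qed.

Lemma isometric_qsum phi phi' psi psi' :
  isometric phi phi' -> isometric psi psi' ->
  isometric (qsum phi psi) (qsum phi' psi').
Proof.
case=> f [lf [f' fK f'K] qf] [g [lg [g' gK g'K] qg]].
exists (fun v : 'rV[F]_(qdim phi + qdim psi) =>
  row_mx (f (lsubmx v)) (g (rsubmx v))); split.
- move=> a u v; rewrite !linearP /= lf lg.
  by rewrite scale_row_mx add_row_mx.
- exists (fun v : 'rV[F]_(qdim phi' + qdim psi') =>
    row_mx (f' (lsubmx v)) (g' (rsubmx v))) => v.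
  + by rewrite row_mxKl row_mxKr fK gK hsubmxK.
  + by rewrite row_mxKl row_mxKr f'K g'K hsubmxK.
- by move=> v; rewrite !qval_qsum row_mxKl row_mxKr qf qg.
Qed.

Lemma qsumC phi psi : isometric (qsum phi psi) (qsum psi phi).
Proof.
exists (fun v : 'rV[F]_(qdim phi + qdim psi) => row_mx (rsubmx v) (lsubmx v)).
split.
- by move=> a u v; rewrite !linearP /= scale_row_mx add_row_mx.
- exists (fun v : 'rV[F]_(qdim psi + qdim phi) =>
    row_mx (rsubmx v) (lsubmx v)) => v;
  by rewrite row_mxKl row_mxKr hsubmxK.
- by move=> v; rewrite !qval_qsum row_mxKl row_mxKr addrC.
Qed.

Lemma qsumA phi psi chi :
  isometric (qsum phi (qsum psi chi)) (qsum (qsum phi psi) chi).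
Proof.
exists (fun v : 'rV[F]_(qdim phi + (qdim psi + qdim chi)) =>
  row_mx (row_mx (lsubmx v) (lsubmx (rsubmx v))) (rsubmx (rsubmx v))).
split.
- by move=> a u v; rewrite !linearP /= !scale_row_mx !add_row_mx.
- exists (fun v : 'rV[F]_((qdim phi + qdim psi) + qdim chi) =>
    row_mx (lsubmx (lsubmx v)) (row_mx (rsubmx (lsubmx v)) (rsubmx v))) => v;
  by rewrite !(row_mxKl, row_mxKr, hsubmxK).
- by move=> v; rewrite !qval_qsum !(row_mxKl, row_mxKr) addrA.
Qed.

Lemma qsum0 phi : isometric (qsum (qzero F) phi) phi.
Proof.
exists (fun v : 'rV[F]_(0 + qdim phi) => rsubmx v); split.
- by move=> a u v; rewrite linearP.
- exists (fun v : 'rV[F]_(qdim phi) => row_mx (0 : 'rV_0) v) => v.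
    by rewrite -[RHS]hsubmxK; congr row_mx; apply/rowP=> -[].
  by rewrite row_mxKr.
- move=> v; rewrite qval_qsum [X in X + _](_ : _ = 0) ?add0r //.
  by rewrite /qval /= mulmx0 mul0mx mxE.
Qed.

Lemma qsumACA a b c d :
  isometric (qsum (qsum a b) (qsum c d)) (qsum (qsum a c) (qsum b d)) (F := F).
Proof.
apply: isometric_trans (isometric_sym (qsumA _ _ _)) _.
apply: isometric_trans (qsumA _ _ _).
apply: isometric_qsum; first exact: isometric_refl.
apply: isometric_trans (qsumA _ _ _) _.
apply: isometric_trans (isometric_sym (qsumA _ _ _)).
by apply: isometric_qsum; [exact: qsumC | exact: isometric_refl].
Qed.

Lemma qmulnD i j phi :
  isometric (qmuln (i + j) phi) (qsum (qmuln i phi) (qmuln j phi)).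
Proof.
elim: i => [|i IHi]; first by apply: isometric_sym; exact: qsum0.
apply: isometric_trans (qsumA _ _ _).
by apply: isometric_qsum => //; exact: isometric_refl.
Qed.

Lemma witt_equiv_isometric phi psi : isometric phi psi -> witt_equiv phi psi.
Proof.
by move=> ?; exists 0%N, 0%N; apply: isometric_qsum => //; exact: isometric_refl.
Qed.

Lemma witt_equiv_sym phi psi : witt_equiv phi psi -> witt_equiv psi phi.
Proof. by case=> i [j h]; exists j, i; exact: isometric_sym. Qed.

Lemma witt_equiv_trans psi phi chi :
  witt_equiv phi psi -> witt_equiv psi chi -> witt_equiv phi chi.
Proof.
set H := hyperbolic_plane F.
case=> i [j h1] [k [l h2]]; exists (i + k)%N, (j + l)%N.
have step xi m p : isometric (qsum xi (qmuln (m + p) H))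
    (qsum (qsum xi (qmuln m H)) (qmuln p H)).
  apply: isometric_trans (qsumA _ _ _).
  by apply: isometric_qsum (qmulnD _ _ _); exact: isometric_refl.
apply: isometric_trans (step _ _ _) _.
apply: isometric_trans (isometric_qsum h1 (isometric_refl _)) _.
apply: isometric_trans (isometric_sym (step _ _ _)) _.
rewrite addnC; apply: isometric_trans (step _ _ _) _.
apply: isometric_trans (isometric_qsum h2 (isometric_refl _)) _.
by rewrite addnC; exact: isometric_sym (step _ _ _).
Qed.

Lemma witt_equiv_qsum phi phi' psi psi' :
  witt_equiv phi phi' -> witt_equiv psi psi' ->
  witt_equiv (qsum phi psi) (qsum phi' psi').
Proof.
set H := hyperbolic_plane F.
case=> i [j h1] [k [l h2]]; exists (i + k)%N, (j + l)%N.
have step xi zeta m p : isometric (qsum (qsum xi zeta) (qmuln (m + p) H))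
    (qsum (qsum xi (qmuln m H)) (qsum zeta (qmuln p H))).
  apply: isometric_trans (qsumACA _ _ _ _).
  by apply: isometric_qsum (qmulnD _ _ _); exact: isometric_refl.
apply: isometric_trans (step _ _ _ _) _.
apply: isometric_trans (isometric_sym (step _ _ _ _)).
exact: isometric_qsum.
Qed.

Definition witt_rel : rel (qform F) := fun phi psi => `[< witt_equiv phi psi >].

Lemma witt_rel_refl : reflexive witt_rel.
Proof. by move=> phi; apply/asboolP/witt_equiv_isometric/isometric_refl. Qed.

Lemma witt_rel_sym : symmetric witt_rel.
Proof. by move=> phi psi; apply/asboolP/asboolP; exact: witt_equiv_sym. Qed.

Lemma witt_rel_trans : transitive witt_rel.
Proof.
by move=> psi phi chi /asboolP h1 /asboolP h2; apply/asboolP; exact: witt_equiv_trans h2.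
Qed.

Canonical witt_rel_equiv := EquivRel witt_rel witt_rel_refl witt_rel_sym witt_rel_trans.

End IsometryTheory.

(* The additive group of the Witt ring WF: forms modulo Witt equivalence, with *)
(* orthogonal sum.  It is only declared as a commutative monoid because        *)
(* fieldType does not exclude 2 = 0; wittN shows it is a group when 2 != 0.    *)
Definition witt (F : fieldType) : Type := {eq_quot (@witt_rel F)}.

Section Witt.
Variable F : fieldType.

HB.instance Definition _ := EqQuotient.on (witt F).
HB.instance Definition _ := Choice.on (witt F).

Definition witt_class (phi : qform F) : witt F := \pi_(witt F) phi.

Lemma witt_classP (phi psi : qform F) :
  witt_class phi = witt_class psi <-> witt_equiv phi psi.
Proof.
by split=> [/eqmodP/asboolP|h] //; apply/eqmodP/asboolP.
Qed.

Definition witt_add (x y : witt F) : witt F :=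
  witt_class (qsum (repr x) (repr y)).

Lemma witt_add_class (phi psi : qform F) :
  witt_add (witt_class phi) (witt_class psi) = witt_class (qsum phi psi).
Proof.
by apply/witt_classP/witt_equiv_qsum; apply/witt_classP; rewrite /witt_class reprK.
Qed.

Lemma wittW (P : witt F -> Prop) :
  (forall phi, P (witt_class phi)) -> forall x, P x.
Proof. by move=> h; elim/quotW. Qed.

Lemma witt_addA : associative witt_add.
Proof.
elim/wittW=> x; elim/wittW=> y; elim/wittW=> z.
rewrite (witt_add_class y z) (witt_add_class x y) (witt_add_class x) witt_add_class.
by apply/witt_classP/witt_equiv_isometric; exact: qsumA.
Qed.

Lemma witt_addC : commutative witt_add.
Proof.
elim/wittW=> x; elim/wittW=> y; rewrite (witt_add_class x y) (witt_add_class y x).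
by apply/witt_classP/witt_equiv_isometric; exact: qsumC.
Qed.

Lemma witt_add0 : left_id (witt_class (qzero F)) witt_add.
Proof.
elim/wittW=> x; rewrite witt_add_class.
by apply/witt_classP/witt_equiv_isometric; exact: qsum0.
Qed.

HB.instance Definition _ := GRing.isNmodule.Build (witt F) witt_addA witt_addC witt_add0.

Lemma witt_classD (phi psi : qform F) :
  witt_class (qsum phi psi) = witt_class phi + witt_class psi.
Proof. by rewrite -witt_add_class. Qed.

Lemma witt_class0 : witt_class (qzero F) = 0.
Proof. by []. Qed.

Lemma witt_classMn (phi : qform F) k : witt_class (qmuln k phi) = witt_class phi *+ k.
Proof.
by elim: k => [|k IHk]; rewrite ?witt_class0 // mulrS -IHk -witt_classD.
Qed.

Lemma row_mx_linear m n1 n2 (a : F) (A A' : 'M[F]_(m, n1)) (B B' : 'M[F]_(m, n2)) :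
  row_mx (a *: A + A') (a *: B + B') = a *: row_mx A B + row_mx A' B'.
Proof. by rewrite scale_row_mx add_row_mx. Qed.

(* k x H, for H the hyperbolic plane, is the form sum_i (x_i^2 - y_i^2). *)
Lemma qmuln_hyperbolic k :
  exists e : 'rV[F]_(k + k) -> 'rV[F]_(qdim (qmuln k (hyperbolic_plane F))),
    [/\ linear e, bijective e &
        forall v, qval (e v) =
          (lsubmx v *m (lsubmx v)^T) 0 0 - (rsubmx v *m (rsubmx v)^T) 0 0].
Proof.
elim: k => [|k [e [le [e' eK e'K] qe]]].
  exists id; split; [by []|by exists id|move=> v].
  by rewrite /qval /= mulmx0 mul0mx !mxE !big_ord0 subr0.
pose l (v : 'rV[F]_(k.+1 + k.+1)) := lsubmx (lsubmx v : 'rV_(1 + k)).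
pose l' (v : 'rV[F]_(k.+1 + k.+1)) := rsubmx (lsubmx v : 'rV_(1 + k)).
pose r (v : 'rV[F]_(k.+1 + k.+1)) := lsubmx (rsubmx v : 'rV_(1 + k)).
pose r' (v : 'rV[F]_(k.+1 + k.+1)) := rsubmx (rsubmx v : 'rV_(1 + k)).
exists (fun v => row_mx (row_mx (l v) (r v)) (e (row_mx (l' v) (r' v)))).
split.
- move=> a u v; rewrite /l /l' /r /r' !linearP /= !row_mx_linear le.
  by rewrite row_mx_linear.
- exists (fun w : 'rV[F]_((1 + 1) + qdim (qmuln k (hyperbolic_plane F))) =>
    row_mx (row_mx (lsubmx (lsubmx w)) (lsubmx (e' (rsubmx w))))
           (row_mx (rsubmx (lsubmx w)) (rsubmx (e' (rsubmx w))))) => v.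
    by rewrite !(row_mxKl, row_mxKr) eK !(row_mxKl, row_mxKr, hsubmxK).
  by rewrite /l /l' /r /r' !(row_mxKl, row_mxKr, hsubmxK) e'K hsubmxK.
- move=> v; rewrite !qval_qsum !(row_mxKl, row_mxKr) qe !(row_mxKl, row_mxKr).
  rewrite /qval /= !mul_mx_scalar !scale1r scaleN1r mulNmx.
  have split1 (w : 'rV[F]_(1 + k)) : (w *m w^T) 0 0 =
      (lsubmx w *m (lsubmx w)^T) 0 0 + (rsubmx w *m (rsubmx w)^T) 0 0.
    by rewrite -{1 2}[w]hsubmxK tr_row_mx mul_row_col mxE.
  rewrite (split1 (lsubmx v)) (split1 (rsubmx v)) [X in _ + X + _]mxE.
  by rewrite opprD addrACA.
Qed.

Definition qopp (phi : qform F) : qform F := qscale (nzN (nz1 F)) phi.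

Lemma difference_of_squares n (B : 'M[F]_n) (x y : 'rV[F]_n) : B^T = B ->
  ((x - y) *m B *m (x + y)^T) 0 0 = (x *m B *m x^T) 0 0 - (y *m B *m y^T) 0 0.
Proof.
move=> symB.
have comm : (y *m B *m x^T) 0 0 = (x *m B *m y^T) 0 0.
  transitivity ((y *m B *m x^T)^T 0 0); first by rewrite [RHS]mxE.
  by rewrite !trmx_mul trmxK symB mulmxA.
rewrite linearD /= mulmxDr !mulmxBl !mxE.
have mulE (u v : 'rV[F]_n) : \sum_j (u *m B) 0 j * v^T j 0 = (u *m B *m v^T) 0 0.
  by rewrite [RHS]mxE.
by rewrite !mulE comm addrA subrK.
Qed.

Lemma qsumN_hyperbolic (phi : qform F) : (2%:R : F) != 0 ->
  isometric (qsum phi (qopp phi)) (qmuln (qdim phi) (hyperbolic_plane F)).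
Proof.
move=> h2; set n := qdim phi; set A : 'M_n := gram phi.
have uA : A \in unitmx := gram_unit phi.
have symA : A^T = A := gram_sym phi.
have [e [le be qe]] := qmuln_hyperbolic n.
pose h : F := 2%:R^-1.
have hh (m1 m2 : nat) (x : 'M[F]_(m1, m2)) : h *: (x + x) = x.
  by rewrite -mulr2n -scaler_nat scalerA mulVf // scale1r.
have avgD (m1 m2 : nat) (x y : 'M[F]_(m1, m2)) : h *: ((x + y) + (x - y)) = x.
  by rewrite addrACA subrr addr0 hh.
have avgB (m1 m2 : nat) (x y : 'M[F]_(m1, m2)) : h *: ((x + y) - (x - y)) = y.
  by rewrite opprB addrC addrA subrK hh.
pose M : 'M[F]_n := h *: (1%:M + A); pose N : 'M[F]_n := h *: (1%:M - A).
have MDN : M + N = 1%:M by rewrite /M /N -scalerDr avgD.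
have MBN : M - N = A by rewrite /M /N -scalerBr avgB.
pose p (v : 'rV[F]_(n + n)) := lsubmx v *m M + rsubmx v *m N.
pose q (v : 'rV[F]_(n + n)) := lsubmx v *m N + rsubmx v *m M.
pose f v := row_mx (p v) (q v).
pose g (w : 'rV[F]_(n + n)) : 'rV[F]_(n + n) :=
  let s := lsubmx w + rsubmx w in
  let d := (lsubmx w - rsubmx w) *m invmx A in
  row_mx (h *: (s + d)) (h *: (s - d)).
have pDq v : p v + q v = lsubmx v + rsubmx v.
  by rewrite /p /q addrACA -!mulmxDr [N + M]addrC MDN !mulmx1.
have pBq v : p v - q v = (lsubmx v - rsubmx v) *m A.
  by rewrite /p /q opprD addrACA -!mulmxBr MBN -[N - M]opprB MBN mulmxN mulmxBl.
exists (e \o f); split.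
- move=> a u v; rewrite /= -le /f; congr (e _).
  rewrite -row_mx_linear /p /q !linearP /= !mulmxDl -!scalemxAl.
  by congr row_mx; rewrite addrACA scalerDr.
- apply: bij_comp be _; exists g => v.
    by rewrite /g /f row_mxKl row_mxKr pDq pBq mulmxK // avgD avgB hsubmxK.
  have sD : p (g v) + q (g v) = lsubmx v + rsubmx v.
    by rewrite pDq /g row_mxKl row_mxKr -scalerDr avgD.
  have sB : p (g v) - q (g v) = lsubmx v - rsubmx v.
    by rewrite pBq /g row_mxKl row_mxKr -scalerBr avgB mulmxKV.
  have pE : p (g v) = lsubmx v by rewrite -[LHS](avgD _ _ _ (q (g v))) sD sB avgD.
  have qE : q (g v) = rsubmx v by rewrite -[LHS](avgB _ _ (p (g v))) sD sB avgB.
  by rewrite /f pE qE hsubmxK.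
- move=> v; rewrite [LHS]qe qval_qsum /f row_mxKl row_mxKr.
  have := difference_of_squares (p v) (q v) (trmx1 F n).
  rewrite !mulmx1 => <-.
  rewrite pDq pBq difference_of_squares // /qval /= scaleN1r mulmxN mulNmx.
  by congr (_ + _); rewrite [RHS]mxE.
Qed.

Lemma wittN (phi : qform F) : (2%:R : F) != 0 ->
  witt_class phi + witt_class (qopp phi) = 0.
Proof.
move=> h2; rewrite -witt_classD -witt_class0; apply/witt_classP.
exists 0%N, (qdim phi).
apply: isometric_trans (qsumC _ _) _.
apply: isometric_trans (qsum0 _) _.
apply: isometric_trans (qsumN_hyperbolic _ h2) _.
exact: isometric_sym (qsum0 _).
Qed.

End Witt.

Section Torsion.

Definition torsion_elt (V : nmodType) (x : V) : Prop :=
  exists2 k : nat, (0 < k)%N & x *+ k = 0.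

Definition kills_torsion (V : nmodType) (k : nat) : Prop :=
  (0 < k)%N /\ forall x : V, torsion_elt x -> x *+ k = 0.

(* The exponent of the torsion subgroup of V; None stands for infinity. *)
Definition torsion_exponent (V : nmodType) : option nat :=
  match pselect (exists k, `[< kills_torsion V k >]) with
  | left ex => Some (ex_minn ex)
  | right _ => None
  end.

Variable F : fieldType.

Definition height : option nat := torsion_exponent (witt F).

Definition torsion_form (phi : qform F) : Prop := torsion_elt (witt_class phi).

Definition supreme_torsion_form (phi : qform F) : Prop :=
  [/\ anisotropic phi, torsion_form phi &
      forall psi : qform F, anisotropic psi -> torsion_form psi ->
        exists2 chi : qform F, subform chi phi & similar psi chi].

End Torsion.

(* Main.v *)
From HB Require Import structures.
Require Import Defs.
From mathcomp Require Import all_boot all_order all_algebra.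
From mathcomp Require Import mxtens boolp zify ring.

Set Implicit Arguments.
Unset Strict Implicit.
Unset Printing Implicit Defensive.

Import GRing.Theory.
Local Open Scope ring_scope.

(* Every form is diagonal, and for b a nonzero sum of 2^r squares the     *)
(* forms 2^r x <a> and 2^r x <a b> are isometric; hence 2^r x psi is Witt *)
(* equivalent to an anisotropic form 2^r x psi'.  If psi is torsion, this *)
(* form is similar to a subform of pi, so 2^r dim psi' <= 2^n, and dim    *)
(* psi' is not 1 because F is real.  For r = n this gives psi' = 0, so    *)
(* 2^n kills W_t F.  For r = n - 1 and 2^r x psi not hyperbolic, pi is    *)
(* similar to 2^r x psi' with psi' binary, and contains 2^r x <1> because *)
(* it represents 1. Conversely, let pi = 2^(n-1) x <1> + chi and let d be *)
(* a nonzero value of chi.  As m pi is hyperbolic for some m > 0, -d is a *)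
(* sum of squares, so <1, d> is torsion; but 2^(n-1) x <1, d> is not      *)
(* hyperbolic, as otherwise 2^(n-1) x <1> would represent -d and pi would *)
(* be isotropic.                                                          *)

(** The engine is Pfister's theory of the forms [2 ^ r x <a_1, ..., a_m>]. A nonzero sum of [2 ^ r]
    squares is a similarity factor of [2 ^ r x <1>] ([sqnorm_similitude]), so each [a_i] may be
    multiplied by such a sum. Hence these forms have anisotropic parts of the same shape
    ([qmuln_qdiag_anisotropic_part]), and a nonzero value [c] splits off the whole of [2 ^ r x <c>]
    ([represents_qmuln_subform]). Supremacy of [pi], of dimension [2 ^ n], bounds such anisotropic
    parts when they are torsion ([torsion_anisotropic_part]); this yields [kills_torsion_supreme]
    and [subform_of_not_kills_torsion]. The converse, [not_kills_torsion_of_subform], exhibits a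
    torsion form [<1, d>] that [2 ^ (n - 1)] does not kill. Since the height divides [2 ^ n], it
    equals [2 ^ n] exactly when [2 ^ (n - 1)] fails to kill the torsion. *)

Section Forms.
Variable F : fieldType.
Implicit Types (phi psi chi : qform F) (a b c d : nonzero F).

(** * Values of forms, and isometries as congruences of Gram matrices *)

Definition represents phi (x : F) : Prop :=
  exists v : 'rV[F]_(qdim phi), qval v = x.

Lemma qval0 phi : @qval F phi 0 = 0.
Proof. by rewrite /qval !mul0mx mxE. Qed.

(** Polarization: the value at [e i + e j] is [2 M i j]. *)
Lemma eq_symmetric_mx0 n (M : 'M[F]_n) : (2%:R : F) != 0 -> M^T = M ->
  (forall v : 'rV_n, (v *m M *m v^T) 0 0 = 0) -> M = 0.
Proof.
move=> two_neq0 symM M0; apply/matrixP=> i j; rewrite [RHS]mxE.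
pose e k : 'rV[F]_n := delta_mx 0 k.
have eE k l : (e k *m M *m (e l)^T) 0 0 = M k l.
  by rewrite trmx_delta -rowE -colE !mxE.
have Mji : M j i = M i j by rewrite -{1}symM mxE.
have := M0 (e i + e j); rewrite linearD /= mulmxDr !mulmxDl !mxE.
have mxE' (u v : 'rV[F]_n) : \sum_k (u *m M) 0 k * v^T k 0 = (u *m M *m v^T) 0 0.
  by rewrite [RHS]mxE.
rewrite !mxE' !M0 !eE Mji add0r addr0 -mulr2n -mulr_natl => /eqP.
by rewrite mulf_eq0 (negPf two_neq0) => /eqP.
Qed.

(** Invertibility of [P] is automatic, because [gram phi] is invertible. The dimensions are equated
    by a hypothesis so that no cast of [P] is needed. *)
Lemma isometric_congr phi psi (P : 'M_(qdim phi, qdim psi)) :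
  qdim phi = qdim psi -> P *m gram psi *m P^T = gram phi -> isometric phi psi.
Proof.
case: phi psi P => n A sA uA [m B sB uB] /= P eq_nm; subst m => PBP.
have [uP _] : P \in unitmx /\ B *m P^T *m invmx A \in unitmx.
  by apply: mulmx1_unit; rewrite !mulmxA PBP mulmxV.
exists (fun v : 'rV_n => v *m P); split.
- by move=> a u v; rewrite mulmxDl scalemxAl.
- by exists (fun v => v *m invmx P) => v; rewrite ?mulmxK ?mulmxKV.
- by move=> v; rewrite /qval /= trmx_mul -PBP !mulmxA.
Qed.

Lemma isometric_mx phi psi : (2%:R : F) != 0 -> isometric phi psi ->
  exists P : 'M_(qdim phi, qdim psi),
    row_free P /\ P *m gram psi *m P^T = gram phi.
Proof.
move=> two_neq0 [f [lf [g fK _] qf]].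
pose fM := GRing.isLinear.Build _ _ _ _ f lf.
pose fL : {linear 'rV_(qdim phi) -> 'rV_(qdim psi)} := HB.pack f fM.
exists (lin1_mx fL); split.
  apply: inj_row_free => v; rewrite mul_rV_lin1 => fv0.
  by apply: (can_inj fK); rewrite [LHS]fv0 [RHS](linear0 fL).
apply/eqP; rewrite -subr_eq0; apply/eqP/eq_symmetric_mx0 => //.
  by rewrite linearB /= !trmx_mul trmxK !gram_sym mulmxA.
move=> v; rewrite mulmxBr mulmxBl [LHS]mxE [X in _ + X]mxE.
apply/eqP; rewrite subr_eq0; apply/eqP.
by have := qf v; rewrite /qval -[f v](mul_rV_lin1 fL) trmx_mul !mulmxA.
Qed.

Lemma isometric_qdim phi psi : (2%:R : F) != 0 -> isometric phi psi ->
  qdim phi = qdim psi.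
Proof.
move=> two_neq0 iso.
have le_qdim (alpha beta : qform F) : isometric alpha beta -> (qdim alpha <= qdim beta)%N.
  case/(isometric_mx two_neq0) => P [/eqP rankP _].
  by rewrite -[X in (X <= _)%N]rankP rank_leq_col.
by apply/eqP; rewrite eqn_leq !le_qdim //; exact: isometric_sym.
Qed.

Lemma isometric_represents phi psi x :
  isometric phi psi -> represents phi x -> represents psi x.
Proof. by case=> f [_ _ qf] [v <-]; exists (f v). Qed.

Lemma isometric_anisotropic phi psi :
  isometric phi psi -> anisotropic phi -> anisotropic psi.
Proof.
move=> /isometric_sym[f [lf [g fK gK] qf]] aniso v qv.
have f0 : f 0 = 0 by have /(_ (-1) 0 0) := lf; rewrite !scaleN1r oppr0 addr0 addNr.
by rewrite -[v]fK (aniso (f v)) ?qf // -f0 fK.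
Qed.

Lemma isometric_witt_class phi psi :
  isometric phi psi -> witt_class phi = witt_class psi.
Proof. by move=> iso; apply/witt_classP/witt_equiv_isometric. Qed.

Lemma represents_qsuml phi psi x : represents phi x -> represents (qsum phi psi) x.
Proof.
case=> v <-; exists (row_mx v 0 : 'rV_(qdim phi + qdim psi)).
by rewrite qval_qsum row_mxKl row_mxKr qval0 addr0.
Qed.

Lemma represents_qmuln k phi x : (0 < k)%N ->
  represents phi x -> represents (qmuln k phi) x.
Proof. by case: k => // k _; exact: represents_qsuml. Qed.

Lemma represents_qline a : represents (qline a) (sval a).
Proof.
exists (1%:M : 'rV[F]_1).
by rewrite /qval /= mul1mx trmx1 mulmx1 mxE eqxx mulr1n.
Qed.

Lemma isometric_qmuln k phi psi :
  isometric phi psi -> isometric (qmuln k phi) (qmuln k psi).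
Proof.
move=> iso; elim: k => [|k IHk]; first exact: isometric_refl.
exact: isometric_qsum.
Qed.

Lemma qsumr0 phi : isometric (qsum phi (qzero F)) phi.
Proof. exact: isometric_trans (qsumC _ _) (qsum0 _). Qed.

Lemma qmuln_qsum k phi psi :
  isometric (qmuln k (qsum phi psi)) (qsum (qmuln k phi) (qmuln k psi)).
Proof.
elim: k => [|k IHk]; first exact: isometric_sym (qsum0 _).
apply: isometric_trans (qsumACA _ _ _ _).
by apply: isometric_qsum IHk; exact: isometric_refl.
Qed.

Lemma isometric_qzero phi : qdim phi = 0%N -> isometric phi (qzero F).
Proof.
move=> phi0; apply: (@isometric_congr _ (qzero F) 0) => //.
by case: phi phi0 => n A /= _ _ n0; subst n; apply/matrixP=> -[].
Qed.

Lemma qdim_qmuln k phi : qdim (qmuln k phi) = (k * qdim phi)%N.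
Proof. by elim: k => //= k ->; rewrite mulSn. Qed.

Lemma qmuln_qmuln k l phi : isometric (qmuln k (qmuln l phi)) (qmuln (k * l) phi).
Proof.
elim: k => [|k IHk]; first exact: isometric_refl.
rewrite mulSn; apply: isometric_trans (isometric_sym (qmulnD _ _ _)).
by apply: isometric_qsum IHk; exact: isometric_refl.
Qed.

Lemma isometric_qscale c phi psi :
  isometric phi psi -> isometric (qscale c phi) (qscale c psi).
Proof.
case=> f [lf bf qf]; exists f; split=> // v.
rewrite /qval /= -!scalemxAr -!scalemxAl ![in LHS]mxE ![in RHS]mxE.
by congr (_ * _); have := qf v; rewrite /qval !mxE.
Qed.

Lemma qscale_qsum c phi psi :
  isometric (qscale c (qsum phi psi)) (qsum (qscale c phi) (qscale c psi)).
Proof.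
apply: (@isometric_congr (qscale c (qsum phi psi)) (qsum (qscale c phi) (qscale c psi))
  (1%:M : 'M[F]_(qdim phi + qdim psi))) => //=.
by rewrite mul1mx trmx1 mulmx1 scale_block_mx !scaler0.
Qed.

Lemma qscale_qmuln c k phi : isometric (qscale c (qmuln k phi)) (qmuln k (qscale c phi)).
Proof.
elim: k => [|k IHk]; first by apply: isometric_qzero.
apply: isometric_trans (qscale_qsum _ _ _) _.
by apply: isometric_qsum IHk; exact: isometric_refl.
Qed.

Lemma qline_mul_sqr a b (x : F) : sval b = sval a * x ^+ 2 -> isometric (qline b) (qline a).
Proof.
move=> bE; apply: (@isometric_congr (qline b) (qline a) (x%:M : 'M[F]_1)) => //=.
by rewrite tr_scalar_mx -!scalar_mxM bE; congr (_%:M); ring.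
Qed.

Lemma qscale_qline c a b : sval b = sval c * sval a ->
  isometric (qscale c (qline a)) (qline b).
Proof.
move=> bE; apply: (@isometric_congr (qscale c (qline a)) (qline b) (1%:M : 'M[F]_1)) => //=.
by rewrite mul1mx trmx1 mulmx1 bE scale_scalar_mx.
Qed.

Lemma qscale_involutive c phi : isometric (qscale c (qscale c phi)) phi.
Proof.
apply: (@isometric_congr (qscale c (qscale c phi)) phi ((sval c)%:M : 'M[F]_(qdim phi))) => //=.
by rewrite tr_scalar_mx mul_mx_scalar mul_scalar_mx.
Qed.

Definition nzM a b : nonzero F :=
  exist (fun x : F => x != 0) (sval a * sval b) (mulf_neq0 (svalP a) (svalP b)).

(* [b d^2 + d b^2 = b d c]: the vectors (1, 1) and (d, -b) are orthogonal for <b, d>. *)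
Lemma qline_qsum b c d : sval c = sval b + sval d ->
  isometric (qsum (qline b) (qline d)) (qsum (qline c) (qline (nzM (nzM b d) c))).
Proof.
move=> cE; apply: isometric_sym.
pose P : 'M[F]_(1 + 1) := block_mx 1%:M 1%:M (sval d)%:M (- sval b)%:M.
apply: (@isometric_congr (qsum (qline c) (qline (nzM (nzM b d) c)))
  (qsum (qline b) (qline d)) P) => //=.
rewrite /P tr_block_mx !tr_scalar_mx !mulmx_block !mulmx0 ?addr0 ?add0r.
rewrite -!scalar_mxM !mul1r !mulr1 -!raddfD /= cE.
congr block_mx; rewrite -?[RHS](raddf0 (@scalar_mx F 1)); congr (_%:M); ring.
Qed.

End Forms.

(** * Totally isotropic subspaces and forms of trivial Witt class *)

Section TotallyIsotropic.
Variable F : fieldType.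
Hypothesis two_neq0 : (2%:R : F) != 0.
Implicit Types (phi psi chi : qform F).

(** The rows of [U] are a basis of a totally isotropic subspace. Tracking its dimension through sums
    with hyperbolic planes takes the place of Witt cancellation. *)
Definition has_isotropic_subspace phi (k : nat) : Prop :=
  exists (m : nat) (U : 'M[F]_(m, qdim phi)),
    [/\ row_free U, U *m gram phi *m U^T = 0 & (k <= m)%N].

Lemma has_isotropic_subspace_rank phi k m (U : 'M_(m, qdim phi)) :
  U *m gram phi *m U^T = 0 -> (k <= \rank U)%N -> has_isotropic_subspace phi k.
Proof.
move=> U0 le_k; exists (\rank U), (row_base U); split=> //.
  exact: row_base_free.
have /submxP[D ->] : (row_base U <= U)%MS by rewrite eq_row_base.
by rewrite trmx_mul -!mulmxA (mulmxA U) (mulmxA _ U^T) U0 mul0mx mulmx0.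
Qed.

Lemma isometric_isotropic_subspace phi psi k : isometric phi psi ->
  has_isotropic_subspace phi k -> has_isotropic_subspace psi k.
Proof.
move=> /(isometric_mx two_neq0)[P [freeP PBP]] [m [U [freeU U0 le_km]]].
exists m, (U *m P); split=> //.
  apply: inj_row_free => v /eqP.
  by rewrite mulmxA mulmx_free_eq0 // mulmx_free_eq0 // => /eqP.
by rewrite trmx_mul !mulmxA -[U *m P *m _]mulmxA -[U *m (P *m _) *m _]mulmxA PBP.
Qed.

(** Adjoin the isotropic vector (1, 1) of the plane. *)
Lemma isotropic_subspace_hyperbolic phi k : has_isotropic_subspace phi k ->
  has_isotropic_subspace (qsum (hyperbolic_plane F) phi) k.+1.
Proof.
case=> m [U [freeU U0 le_km]].
pose W : 'M[F]_(1 + m, (1 + 1) + qdim phi) := block_mx (row_mx 1%:M 1%:M) 0 0 U.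
exists (1 + m)%N, W; split; last by rewrite add1n ltnS.
  apply: inj_row_free => v; rewrite -[v]hsubmxK mul_row_block !mulmx0 addr0 add0r.
  rewrite mul_mx_row mulmx1 -[RHS]row_mx0 => /eq_row_mx[].
  rewrite -[RHS]row_mx0 => /eq_row_mx[-> _] /eqP.
  by rewrite mulmx_free_eq0 // => /eqP->; rewrite row_mx0.
rewrite /W /= tr_block_mx !mulmx_block !trmx0 !(mulmx0, mul0mx) !(addr0, add0r) U0.
rewrite mul_row_block !mulmx0 addr0 add0r tr_row_mx mul_row_col.
rewrite !trmx1 !mulmx1 !mul1mx.
rewrite -raddfD /= subrr raddf0 ?mul0mx; exact: block_mx0.
Qed.

Lemma isotropic_subspace_qmuln k : has_isotropic_subspace (qmuln k (hyperbolic_plane F)) k.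
Proof.
elim: k => [|k IHk]; last exact: isotropic_subspace_hyperbolic.
by exists 0%N, 0; split=> //; rewrite ?mul0mx // /row_free mxrank0.
Qed.

(* [U] meets the hyperplane orthogonal to the isotropic vector (0, 1, 1)  *)
(* in a subspace whose projection to [phi] is totally isotropic; the      *)
(* projection kills at most the multiples of (0, 1, 1), and if that       *)
(* vector lies in [U] then [U] is contained in the hyperplane.            *)
Lemma isotropic_subspace_cancel phi k :
  has_isotropic_subspace (qsum phi (hyperbolic_plane F)) k.+1 ->
  has_isotropic_subspace phi k.
Proof.
case=> m [U [freeU U0 lt_km]].
pose X : 'M[F]_(m, qdim phi) := lsubmx (U : 'M_(m, qdim phi + (1 + 1))).
pose Y : 'M[F]_(m, 1) := lsubmx (rsubmx (U : 'M_(m, qdim phi + (1 + 1)))).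
pose Z : 'M[F]_(m, 1) := rsubmx (rsubmx (U : 'M_(m, qdim phi + (1 + 1)))).
have UE : U = row_mx X (row_mx Y Z) by rewrite /X /Y /Z !hsubmxK.
have {}U0 : X *m gram phi *m X^T + (Y *m Y^T - Z *m Z^T) = 0.
  move: U0; rewrite UE /= mul_row_block !mulmx0 addr0 add0r tr_row_mx mul_row_col.
  rewrite mul_row_block !mulmx0 addr0 add0r tr_row_mx mul_row_col.
  by rewrite !mul_mx_scalar scale1r scaleN1r mulNmx.
pose K := kermx (Y - Z).
have KYZ : K *m Y = K *m Z by apply/eqP; rewrite -subr_eq0 -mulmxBr mulmx_ker.
apply: (@has_isotropic_subspace_rank _ _ _ (K *m X)).
  have := congr1 (fun M => K *m M *m K^T) U0.
  rewrite mulmx0 mul0mx mulmxDr mulmxBr mulmxDl mulmxBl !mulmxA KYZ.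
  rewrite -![K *m Z *m _ *m _]mulmxA -!trmx_mul KYZ subrr addr0.
  by move=> XGX; rewrite trmx_mul !mulmxA; exact: XGX.
(* By rank-nullity for the projection to [phi], it suffices that [\rank (Y - Z)] and the dimension
   of [K :&: kermx X] add up to at most 1. *)
rewrite -ltnS -(leq_add2r (\rank (K :&: kermx X)%MS)) [X in (_ <= X)%N]addSn mxrank_mul_ker.
apply: leq_trans (leq_add lt_km (leqnn _)) _; rewrite mxrank_ker.
have kerXE (v : 'rV_m) : v *m X = 0 -> v *m Y = v *m Z ->
    v *m U = v *m Y *m row_mx 0 (row_mx 1%:M 1%:M).
  by move=> vX vYZ; rewrite UE !mul_mx_row vX -vYZ mulmx0 mulmx1.
have [YZ|YZ] := eqVneq Y Z.
  rewrite YZ subrr mxrank0 subn0 -addn1 leq_add2l.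
  apply: leq_trans (mxrankS (capmxSr _ _)) _; rewrite -(mxrankMfree _ freeU).
  apply: leq_trans (rank_leq_row (row_mx 0 (row_mx 1%:M 1%:M) : 'M[F]_(1, qdim phi + (1 + 1)))).
  apply/mxrankS/row_subP => i; rewrite row_mul kerXE ?submxMl ?YZ //.
  by rewrite -row_mul mulmx_ker row0.
have -> : \rank (K :&: kermx X)%MS = 0%N.
  apply/eqP; rewrite mxrank_eq0; apply/eqP/row_matrixP => i; rewrite row0.
  set v := row i _; have : (v <= K :&: kermx X)%MS by exact: row_sub.
  rewrite sub_capmx => /andP[/sub_kermxP vYZ /sub_kermxP vX].
  have {}vYZ : v *m Y = v *m Z by apply/eqP; rewrite -subr_eq0 -mulmxBr vYZ.
  apply/eqP; rewrite -(mulmx_free_eq0 _ freeU) kerXE //.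
  suff -> : v *m Y = 0 by rewrite mul0mx.
  (* Pairing [v *m U] with all rows of [U] gives [v *m Y *m (Y - Z)^T = 0]; as [Y - Z] is nonzero,
     the scalar [v *m Y] vanishes. *)
  have := congr1 (mulmx v) U0; rewrite mulmx0 mulmxDr mulmxBr !mulmxA vX !mul0mx add0r.
  rewrite -vYZ -mulmxBr -linearB /= [v *m Y]mx11_scalar mul_scalar_mx => /eqP.
  rewrite scaler_eq0 -trmx_eq0 trmxK subr_eq0 (negPf YZ) orbF => /eqP->.
  by rewrite raddf0.
by rewrite addn0 -addn1; have := rank_leq_col (Y - Z); lia.
Qed.

Lemma isotropic_subspace_cancel_qmuln phi i k :
  has_isotropic_subspace (qsum phi (qmuln i (hyperbolic_plane F))) (k + i) ->
  has_isotropic_subspace phi k.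
Proof.
elim: i => [|i IHi].
  by rewrite addn0; apply: isometric_isotropic_subspace; exact: qsumr0.
rewrite addnS => ti; apply/IHi/isotropic_subspace_cancel.
apply: isometric_isotropic_subspace ti.
apply: isometric_trans (qsumA _ _ _).
by apply: isometric_qsum (qsumC _ _); exact: isometric_refl.
Qed.

(** If [phi] plus [i] planes is isometric to [j] planes, it has a totally isotropic subspace of
    dimension [j]; cancelling the [i] planes leaves [j - i], half of [qdim phi]. *)
Lemma isotropic_subspace_witt_class0 phi : witt_class phi = 0 ->
  exists2 k, (qdim phi = k + k)%N & has_isotropic_subspace phi k.
Proof.
rewrite -witt_class0 => /witt_classP[i [j iso]].
have dimE : (qdim phi + (i + i) = j + j)%N.
  by have := isometric_qdim two_neq0 iso; rewrite /= !qdim_qmuln /=; lia.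
exists (j - i)%N; first by lia.
apply: (@isotropic_subspace_cancel_qmuln _ i); rewrite subnK; last by lia.
apply: isometric_isotropic_subspace (isotropic_subspace_qmuln j).
exact: isometric_trans (isometric_sym (qsum0 _)) (isometric_sym iso).
Qed.

Lemma anisotropic_witt_class0 phi :
  anisotropic phi -> witt_class phi = 0 -> qdim phi = 0%N.
Proof.
move=> aniso /isotropic_subspace_witt_class0[k -> [m [U [freeU U0 le_km]]]].
suff : m = 0%N by lia.
move: freeU; rewrite /row_free; suff -> : U = 0 by rewrite mxrank0 => /eqP.
apply/row_matrixP => i; rewrite row0; apply: aniso.
by rewrite /qval rowE trmx_mul -!mulmxA (mulmxA U) (mulmxA _ U^T) U0 mul0mx mulmx0 mxE.
Qed.

(* The totally isotropic subspace has dimension [qdim psi], and its projection *)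
(* to [psi] is injective because [phi] is anisotropic.                         *)
Lemma represents_opp phi psi x : anisotropic phi -> qdim phi = qdim psi ->
  witt_class (qsum phi psi) = 0 -> represents psi x -> represents phi (- x).
Proof.
move=> aniso eq_dim /isotropic_subspace_witt_class0[k dimE [m [U [freeU U0 le_km]]]].
have U0v (v : 'rV_m) : @qval F (qsum phi psi) (v *m U) = 0.
  by rewrite /qval trmx_mul -!mulmxA (mulmxA U) (mulmxA _ U^T) U0 mul0mx mulmx0 mxE.
pose V := rsubmx (U : 'M_(m, qdim phi + qdim psi)).
have freeV : row_free V.
  apply: inj_row_free => v vV; apply/eqP; rewrite -(mulmx_free_eq0 _ freeU).
  have rU : rsubmx (v *m U : 'rV_(qdim phi + qdim psi)) = 0.
    by rewrite -mulmx_rsub.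
  have := U0v v; rewrite qval_qsum rU qval0 addr0 => /aniso lU.
  by rewrite -[v *m U]hsubmxK lU rU row_mx0.
have /row_fullP[B BV] : row_full V.
  rewrite /row_full eqn_leq rank_leq_col; move/eqP: freeV => ->.
  by move: dimE => /=; lia.
case=> w <-; exists (lsubmx (w *m B *m U : 'rV_(qdim phi + qdim psi))).
have := U0v (w *m B); rewrite qval_qsum => /eqP; rewrite addr_eq0 => /eqP->.
by rewrite -mulmx_rsub -mulmxA BV mulmx1.
Qed.

End TotallyIsotropic.

(** * Diagonal forms and diagonalization *)

Section Diagonal.
Variable F : fieldType.
Implicit Types (phi psi chi : qform F) (a b c d : nonzero F) (s t : seq (nonzero F)).

Definition qdiag s : qform F := foldr (fun a phi => qsum (qline a) phi) (qzero F) s.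

Lemma qdim_qdiag s : qdim (qdiag s) = size s.
Proof. by elim: s => //= a s ->. Qed.

Lemma witt_class_qdiag s :
  witt_class (qdiag s) = \sum_(a <- s) witt_class (qline a).
Proof.
elim: s => [|a s IHs]; first by rewrite big_nil.
by rewrite big_cons -IHs -witt_classD.
Qed.

(** Iterates [qline_qsum] from the end of the list. When the tail sums to 0 the head is already [c],
    and nothing is merged. *)
Lemma qdiag_split_sum s c : \sum_(a <- s) sval a = sval c ->
  exists2 t, (size t).+1 = size s & isometric (qdiag s) (qsum (qline c) (qdiag t)).
Proof.
elim: s c => [|a s IHs] c.
  by rewrite big_nil => c0; have := svalP c; rewrite -c0 eqxx.
rewrite big_cons; set x := \sum_(b <- s) _.
have [-> | x_neq0] := eqVneq x 0.
  rewrite addr0 => /val_inj ->; exists s => //; exact: isometric_refl.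
pose d : nonzero F := exist (fun y : F => y != 0) x x_neq0.
have [t sizet iso] := IHs d erefl => cE; exists (nzM (nzM a d) c :: t).
  by rewrite /= sizet.
apply: isometric_trans (isometric_qsum (isometric_refl _) iso) _.
apply: isometric_trans (qsumA _ _ _) _.
apply: isometric_trans (isometric_sym (qsumA _ _ _)).
by apply: isometric_qsum (isometric_refl _); apply: qline_qsum.
Qed.

Lemma qsumCA phi psi chi :
  isometric (qsum phi (qsum psi chi)) (qsum psi (qsum phi chi)).
Proof.
apply: isometric_trans (qsumA _ _ _) _.
apply: isometric_trans (isometric_sym (qsumA _ _ _)).
by apply: isometric_qsum (qsumC _ _) (isometric_refl _).
Qed.

Lemma exists_qval_neq0 phi : (2%:R : F) != 0 -> (0 < qdim phi)%N ->
  exists v : 'rV_(qdim phi), @qval F phi v != 0.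
Proof.
move=> two_neq0 dim_gt0; apply: contrapT => /forallNP no_v.
have gram0 : gram phi = 0.
  apply: eq_symmetric_mx0 (gram_sym phi) _ => // v.
  by apply/eqP/negPn/negP; exact: no_v.
have := gram_unit phi; rewrite gram0 => unit0.
have := mulmxV unit0; rewrite mul0mx => /matrixP/(_ (Ordinal dim_gt0) (Ordinal dim_gt0)).
by rewrite !mxE eqxx => /eqP; rewrite eq_sym oner_eq0.
Qed.

Lemma exists_unitmx_first_row n (v : 'rV[F]_(1 + n)) : v != 0 ->
  exists (P : 'M_(1 + n)) (x : F), P \in unitmx /\ v = x *: usubmx P.
Proof.
move=> v_neq0; exists (row_ebase v), (col_ebase v 0 0); split.
  exact: row_ebase_unit.
have rank_v : \rank v = 1%N.
  by apply/eqP; rewrite eqn_leq rank_leq_row lt0n mxrank_eq0.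
rewrite -{1}[v]mulmx_ebase rank_v pid_mx_row {1}[col_ebase v]mx11_scalar.
by rewrite mul_scalar_mx -scalemxAl -{1}[row_ebase v]vsubmxK mul_row_col mul1mx mul0mx addr0.
Qed.

Lemma diagonalization phi : (2%:R : F) != 0 -> exists s, isometric phi (qdiag s).
Proof.
move=> two_neq0; have [n dimE] : exists n, qdim phi = n by exists (qdim phi).
elim: n phi dimE => [|n IHn] phi dimE; first by exists [::]; exact: isometric_qzero.
have [v qv] : exists v : 'rV_(qdim phi), qval v != 0.
  by apply: exists_qval_neq0; rewrite ?dimE.
case: phi dimE v qv => m A symA unitA /= mE; subst m => v qv.
have v_neq0 : v != 0 by apply: contraNneq qv => ->; rewrite qval0.
have [P [x [unitP vE]]] := exists_unitmx_first_row v_neq0.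
pose B : 'M_(1 + n) := P *m A *m P^T.
have symB : B^T = B by rewrite /B !trmx_mul trmxK symA mulmxA.
have unitB : B \in unitmx by rewrite !unitmx_mul unitP unitA unitmx_tr.
pose e := B 0 0.
have ulB : ulsubmx B = e%:M by rewrite [LHS]mx11_scalar mxE [X in X%:M]mxE !lshift0.
have e_neq0 : e != 0.
  apply: contraNneq qv => e0.
  have Pu : usubmx P *m A *m (usubmx P)^T = ulsubmx B.
    by rewrite /B -{3 4}[P]vsubmxK tr_col_mx !mul_col_mx !mul_mx_row block_mxKul.
  by rewrite /qval vE /= linearZ /= -!scalemxAl -scalemxAr Pu ulB e0 raddf0 !scaler0 mxE.
pose u := ursubmx B; pose C := drsubmx B.
have BE : B = block_mx e%:M u u^T C.
  by rewrite -[LHS]submxK ulB -/u -/C trmx_ursub symB.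
(* Schur complement of the entry [e]: the Gram matrix on the orthogonal complement of the first
   basis vector. *)
pose D := C - e^-1 *: (u^T *m u).
have symC : C^T = C by rewrite /C trmx_drsub symB.
have symD : D^T = D by rewrite /D linearB /= linearZ /= trmx_mul trmxK symC.
pose L : 'M[F]_(1 + n) := block_mx 1%:M 0 (- e^-1 *: u^T) 1%:M.
have LBL : L *m B *m L^T = block_mx e%:M 0 0 D.
  rewrite BE /L tr_block_mx !trmx1 !trmx0 !mulmx_block !linearZ /= trmxK.
  rewrite !(mul1mx, mulmx1, mul0mx, mulmx0, addr0, add0r) !mul_scalar_mx !mul_mx_scalar.
  rewrite !scalerA !mulrN mulfV // mulNr mulVf // !scaleN1r !scaleNr !addNr.
  by rewrite mul0mx scaler0 oppr0 add0r addrC mulNmx -scalemxAl.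
have unitL : L \in unitmx by rewrite unitmxE det_lblock !det1 mulr1 unitr1.
have unitD : D \in unitmx.
  have : L *m B *m L^T \in unitmx by rewrite unitmx_mul unitmx_mul unitmx_tr unitL unitB.
  by rewrite LBL unitmxE det_ublock unitrM -!unitmxE => /andP[].
have [s iso] := IHn (QForm symD unitD) erefl.
pose a : nonzero F := exist (fun y : F => y != 0) e e_neq0.
exists (a :: s).
apply: isometric_trans (isometric_qsum (isometric_refl _) iso).
apply: isometric_sym.
apply: (@isometric_congr _ (qsum (qline a) (QForm symD unitD)) (QForm symA unitA) (L *m P)) => //=.
by rewrite trmx_mul -LBL /B !mulmxA.
Qed.

End Diagonal.

(** * Sums of squares in a real field, and multiples of diagonal forms *)

Section SumsOfSquares.
Variable F : fieldType.
Hypothesis F_real : formally_real F.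
Implicit Types (phi psi chi : qform F) (a b c d : nonzero F) (s t : seq (nonzero F)).

Lemma formally_real_two_neq0 : (2%:R : F) != 0.
Proof.
apply: contra_notN F_real => /eqP two0; exists [:: 1].
by rewrite big_seq1 expr1n; apply/esym/eqP; rewrite -subr_eq0 opprK -two0.
Qed.
Let two_neq0 := formally_real_two_neq0.

Definition sqnorm k (x : 'rV[F]_k) : F := (x *m x^T) 0 0.

Lemma sqnormE k (x : 'rV_k) : sqnorm x = \sum_i x 0 i ^+ 2.
Proof. by rewrite /sqnorm mxE; apply: eq_bigr => i _; rewrite mxE expr2. Qed.

Lemma sqnorm_row_mx k l (x : 'rV_k) (y : 'rV_l) :
  sqnorm (row_mx x y) = sqnorm x + sqnorm y.
Proof. by rewrite /sqnorm tr_row_mx mul_row_col mxE. Qed.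

Lemma sqnorm_eq0 k (x : 'rV_k) : sqnorm x = 0 -> x = 0.
Proof.
rewrite sqnormE => sum0; apply/rowP=> j; rewrite mxE; apply: contra_notP F_real => /eqP xj.
(* Dividing the vanishing sum by the square of [x 0 j] writes -1 as a sum of squares. *)
exists [seq x 0 i / x 0 j | i <- enum 'I_k & i != j].
rewrite big_map big_filter big_enum_cond /= (eq_bigr (fun i => x 0 i ^+ 2 * x 0 j ^- 2)).
  rewrite -mulr_suml; move: sum0; rewrite (bigD1 j) //= => /eqP.
  rewrite addrC addr_eq0 => /eqP ->.
  by rewrite mulNr mulfV // expf_neq0.
by move=> i _; rewrite expr_div_n.
Qed.

Lemma qscalar_sym k a : ((sval a)%:M : 'M_k)^T = (sval a)%:M.
Proof. exact: tr_scalar_mx. Qed.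

Lemma qscalar_unit k a : ((sval a)%:M : 'M_k) \in unitmx.
Proof. by rewrite unitmxE det_scalar unitrX // unitfE; exact: (svalP a). Qed.

(** A one-block model of [k x <a>], on which similitudes act as plain matrices. *)
Definition qscalar k a : qform F := QForm (qscalar_sym k a) (qscalar_unit k a).

Lemma qval_qscalar k a (v : 'rV_k) : @qval F (qscalar k a) v = sval a * sqnorm v.
Proof. by rewrite /qval /= mul_mx_scalar -scalemxAl mxE. Qed.

Lemma qmuln_qline k a : isometric (qmuln k (qline a)) (qscalar k a).
Proof.
elim: k => [|k IHk]; first exact/isometric_sym/isometric_qzero.
apply: isometric_trans (isometric_qsum (isometric_refl _) IHk) _.
apply: (@isometric_congr _ (qsum (qline a) (qscalar k a)) (qscalar k.+1 a)
  (1%:M : 'M_(1 + k))) => //=.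
by rewrite mul1mx trmx1 mulmx1 (scalar_mx_block 1 k).
Qed.

Lemma qmuln_qline_anisotropic k a : anisotropic (qmuln k (qline a)).
Proof.
apply: isometric_anisotropic (isometric_sym (qmuln_qline k a)) _ => v.
rewrite qval_qscalar => /eqP; rewrite mulf_eq0 (negPf (svalP a)) /=.
by move=> /eqP/sqnorm_eq0.
Qed.

(** All multiples of this form are again of the form [l x <a>], hence anisotropic. *)
Lemma qmuln_qline_not_torsion k a : (0 < k)%N -> ~ torsion_form (qmuln k (qline a)).
Proof.
move=> k_gt0 [m m_gt0]; rewrite -witt_classMn (isometric_witt_class (qmuln_qmuln _ _ _)).
move=> /(anisotropic_witt_class0 two_neq0 (@qmuln_qline_anisotropic _ _)).
rewrite qdim_qmuln /=; lia.
Qed.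

(* Writing x = (x1, x2) with similitudes A and B for x1 and x2, take T =  *)
(* [A, B; X, A^T] when |x1|^2 is nonzero; X is then forced by the         *)
(* orthogonality of the rows.                                             *)
Lemma sqnorm_similitude r (x : 'rV_(2 ^ r)) : exists T : 'M[F]_(2 ^ r),
  T *m T^T = (sqnorm x)%:M /\ T^T *m T = (sqnorm x)%:M.
Proof.
have [k kE] : exists k, k = (2 ^ r)%N by exists (2 ^ r)%N.
move: x; rewrite -kE; elim: r k kE => [|r IHr] k kE.
  move: kE; rewrite expn0 => -> x; exists (x 0 0)%:M.
  by rewrite tr_scalar_mx -scalar_mxM sqnormE big_ord1 expr2.
move: kE; rewrite expnS mul2n -addnn => -> x; set l := (2 ^ r)%N in x *.
rewrite -[x]hsubmxK sqnorm_row_mx.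
have [A [AAt AtA]] := IHr l erefl (lsubmx x).
have [B [BBt BtB]] := IHr l erefl (rsubmx x).
set p := sqnorm (lsubmx x) in AAt AtA *; set q := sqnorm (rsubmx x) in BBt BtB *.
have [->|p_neq0] := eqVneq p 0.
  exists (block_mx B 0 0 B); rewrite add0r tr_block_mx !trmx0 !mulmx_block.
  by rewrite !mulmx0 !mul0mx !addr0 !add0r BBt BtB -scalar_mx_block.
pose X := - p^-1 *: (A^T *m B^T *m A).
have XT : X^T = - p^-1 *: (A^T *m B *m A) by rewrite linearZ /= !trmx_mul !trmxK mulmxA.
exists (block_mx A B X A^T).
have pVp : p^-1 * p = 1 by rewrite mulVf.
have AXt : A *m X^T = - (B *m A).
  by rewrite XT -scalemxAr !mulmxA AAt mul_scalar_mx -scalemxAl scalerA mulNr pVp scaleN1r.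
have XAt : X *m A^T = - (A^T *m B^T).
  by rewrite -scalemxAl -!mulmxA AAt !mul_mx_scalar -scalemxAr scalerA mulNr pVp scaleN1r.
have XtAt : X^T *m A^T = - (A^T *m B).
  by rewrite XT -scalemxAl -!mulmxA AAt !mul_mx_scalar -scalemxAr scalerA mulNr pVp scaleN1r.
have XXt : X *m X^T = q%:M.
  transitivity (- p^-1 *: (A^T *m B^T *m (A *m X^T))).
    by rewrite {1}/X -scalemxAl !mulmxA.
  rewrite AXt mulmxN mulmxA -[_ *m B]mulmxA BtB mul_mx_scalar -scalemxAl AtA.
  by rewrite scaleNr scalerN opprK scalerA scale_scalar_mx -mulrA [q * p]mulrC mulrA pVp mul1r.
have XtX : X^T *m X = q%:M.
  transitivity (- p^-1 *: (X^T *m A^T *m B^T *m A)).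
    by rewrite {2}/X -scalemxAr !mulmxA.
  rewrite XtAt !mulNmx -[_ *m B *m _]mulmxA BBt mul_mx_scalar -scalemxAl AtA.
  by rewrite scaleNr scalerN opprK scalerA scale_scalar_mx -mulrA [q * p]mulrC mulrA pVp mul1r.
have AX : A *m X = - (B^T *m A).
  by rewrite -scalemxAr !mulmxA AAt mul_scalar_mx -scalemxAl scalerA mulNr pVp scaleN1r.
rewrite tr_block_mx trmxK !mulmx_block.
rewrite AXt XXt XtX XtAt AX XAt AAt BBt AtA BtB !addNr !subrr -!raddfD /= [q + p]addrC.
by rewrite -scalar_mx_block.
Qed.

Lemma qmuln_qline_nzM r a b (x : 'rV_(2 ^ r)) : sval b = sqnorm x ->
  isometric (qmuln (2 ^ r) (qline a)) (qmuln (2 ^ r) (qline (nzM a b))).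
Proof.
move=> bE; apply: isometric_trans (qmuln_qline _ _) _.
apply: isometric_sym; apply: isometric_trans (qmuln_qline _ _) _.
have [T [TTt _]] := sqnorm_similitude x.
apply: (@isometric_congr _ (qscalar (2 ^ r) (nzM a b)) (qscalar (2 ^ r) a) T) => //=.
by rewrite mul_mx_scalar -scalemxAl TTt scale_scalar_mx bE.
Qed.

(** [k x qdiag s] regrouped by coefficient, so that the block [k x <a>] can be replaced for one [a]
    at a time. *)
Fixpoint qmdiag k s : qform F :=
  if s is a :: t then qsum (qmuln k (qline a)) (qmdiag k t) else qzero F.

Lemma qmdiagE k s : isometric (qmdiag k s) (qmuln k (qdiag s)).
Proof.
elim: s => [|a s IHs] /=; first by apply/isometric_sym/isometric_qzero; rewrite qdim_qmuln muln0.
apply: isometric_trans (isometric_sym (qmuln_qsum _ _ _)).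
by apply: isometric_qsum IHs; exact: isometric_refl.
Qed.

(** A block with coefficient [a] contributes [a * sqnorm x]. Where this is nonzero, [s1] receives it
    in place of [a]; the other coefficients go to [s2] unchanged. The last clause makes [s1]
    nonempty for an isotropic vector. *)
Lemma qmdiag_value r s (v : 'rV_(qdim (qmdiag (2 ^ r) s))) : exists s1 s2,
  [/\ (size s1 + size s2 = size s)%N,
      isometric (qmdiag (2 ^ r) s) (qsum (qmdiag (2 ^ r) s1) (qmdiag (2 ^ r) s2)),
      qval v = \sum_(a <- s1) sval a & s1 = [::] -> v = 0].
Proof.
elim: s v => [|a s IHs] v.
  exists [::], [::]; split=> //; first exact/isometric_sym/qsum0.
    by rewrite big_nil /qval /= mulmx0 mul0mx mxE.
  by move=> _; apply/rowP=> -[].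
have [s1 [s2 [sizes iso vE s10]]] := IHs (rsubmx (v : 'rV_(_ + qdim (qmdiag (2 ^ r) s)))).
set v1 := lsubmx (v : 'rV_(qdim (qmuln (2 ^ r) (qline a)) + qdim (qmdiag (2 ^ r) s))).
have qvE : qval v = qval v1 + \sum_(b <- s1) sval b by rewrite -vE [LHS]qval_qsum.
have [x v1E] : exists x : 'rV_(2 ^ r), qval v1 = sval a * sqnorm x.
  have [f [_ _ qf]] := qmuln_qline (2 ^ r) a.
  by exists (f v1); rewrite -qf qval_qscalar.
have [x0|x_neq0] := eqVneq (sqnorm x) 0.
  exists s1, (a :: s2); split=> /=.
  - by rewrite addnS sizes.
  - apply: isometric_trans (qsumCA _ _ _).
    by apply: isometric_qsum iso; exact: isometric_refl.
  - by rewrite qvE v1E x0 mulr0 add0r.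
  - move=> /s10 v2; rewrite -[v]hsubmxK v2 -/v1.
    suff -> : v1 = 0 by rewrite row_mx0.
    by apply: qmuln_qline_anisotropic; rewrite v1E x0 mulr0.
pose b : nonzero F := exist (fun y : F => y != 0) (sqnorm x) x_neq0.
exists (nzM a b :: s1), s2; split=> //=.
- by rewrite addSn sizes.
- apply: isometric_trans (qsumA _ _ _).
  by apply: isometric_qsum iso; exact: qmuln_qline_nzM.
- by rewrite big_cons qvE v1E.
Qed.

Lemma witt_class_qline_nzN a : witt_class (qline a) + witt_class (qline (nzN a)) = 0.
Proof.
rewrite -(wittN (qline a) two_neq0); congr (_ + _); apply/esym/isometric_witt_class.
by apply: qscale_qline; rewrite /= mulN1r.
Qed.

(* Pfister: an isotropic form 2^r x <a_1, ..., a_m> has a zero sum among  *)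
(* suitable a_i b_i with the b_i sums of 2^r squares, and 2^r x <a_i> and *)
(* 2^r x <a_i b_i> are isometric; so a hyperbolic plane splits off <...,  *)
(* a_i b_i, ...> itself.                                                  *)
Lemma qmuln_qdiag_anisotropic_part r s : exists t,
  witt_class (qmuln (2 ^ r) (qdiag s)) = witt_class (qmuln (2 ^ r) (qdiag t)) /\
  anisotropic (qmuln (2 ^ r) (qdiag t)).
Proof.
have [m] := ubnP (size s); elim: m s => // m IHm s; rewrite ltnS => le_s.
have [aniso|] := pselect (anisotropic (qmdiag (2 ^ r) s)).
  by exists s; split=> //; apply: isometric_anisotropic aniso; exact: qmdiagE.
move=> /existsNP[v /not_implyP[qv v_neq0]].
have [[|a s1] [s2 [sizes iso]]] := qmdiag_value v; first by move=> _ /(_ erefl).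
rewrite qv big_cons => /esym/eqP; rewrite addrC addr_eq0 => /eqP sum_s1 _.
have [t sizet iso_t] := @qdiag_split_sum _ s1 (nzN a) sum_s1.
have [|t' [cls aniso]] := IHm (t ++ s2).
  by rewrite size_cat; move: sizes le_s => /=; lia.
exists t'; split=> //; rewrite -cls -(isometric_witt_class (qmdiagE _ _)).
rewrite (isometric_witt_class iso) witt_classD !(isometric_witt_class (qmdiagE _ _)).
rewrite !witt_classMn -mulrnDl; congr (_ *+ _).
rewrite -[qdiag (a :: s1)]/(qsum _ _) witt_classD (isometric_witt_class iso_t).
by rewrite witt_classD addrA witt_class_qline_nzN add0r !witt_class_qdiag big_cat.
Qed.

End SumsOfSquares.

(** * The exponent of the torsion as a divisor *)

Section TorsionExponent.
Variable V : nmodType.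

Lemma kills_torsion_dvdn k l : kills_torsion V k -> (k %| l)%N -> (0 < l)%N ->
  kills_torsion V l.
Proof.
move=> [_ killk] /dvdnP[q ->] l_gt0; split=> // x tx.
by rewrite mulnC mulrnA killk // mul0rn.
Qed.

(** A nonzero remainder modulo the least killing number would be a smaller one. Divisibility,
    stronger than minimality, makes the height a power of 2. *)
Lemma torsion_exponentP k : kills_torsion V k -> exists h,
  [/\ torsion_exponent V = Some h, kills_torsion V h &
      forall l, kills_torsion V l -> (h %| l)%N].
Proof.
move=> killk; rewrite /torsion_exponent; case: pselect => [ex|[]]; last first.
  by exists k; apply/asboolP.
case: ex_minnP => h /asboolP[h_gt0 killh] min_h; exists h; split=> // l [_ kill_l].
apply/negPn/negP; rewrite /dvdn -lt0n => r_gt0.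
suff /asboolP/min_h : kills_torsion V (l %% h) by rewrite leqNgt ltn_pmod.
split=> // x tx; have := kill_l x tx.
by rewrite {1}(divn_eq l h) mulrnDr mulnC mulrnA killh // mul0rn add0r.
Qed.

End TorsionExponent.

(** * The two implications for a supreme torsion form *)

Section SupremeTorsionForms.
Variable F : fieldType.
Hypothesis F_real : formally_real F.
Implicit Types (phi psi chi pi : qform F) (a b c d : nonzero F) (s t : seq (nonzero F)).
Let two_neq0 := formally_real_two_neq0 F_real.

Lemma qdim_qpfister s : qdim (qpfister s) = (2 ^ size s)%N.
Proof. by elim: s => //= a s ->; rewrite expnS. Qed.

Lemma represents_qtens phi psi x y :
  represents phi x -> represents psi y -> represents (qtens phi psi) (x * y).
Proof.
case=> u <- [v <-]; exists (tensmx u v : 'M_(1, _)).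
(* The single row of [tensmx u v] is indexed by ['I_(1 * 1)]; presenting 0 as a pair lets [tensmxE]
   apply. *)
pose i : 'I_(1 * 1) := mxtens_index (0, 0).
have i0 : i = 0 :> 'I_1 by rewrite [LHS]ord1.
transitivity ((tensmx u v *m tensmx (gram phi) (gram psi) *m (tensmx u v)^T) i i).
  by rewrite /qval -i0.
by rewrite trmx_tens !tensmx_mul tensmxE.
Qed.

Lemma qpfister_represents1 s : represents (qpfister s) 1.
Proof.
elim: s => [|a s IHs] /=; first exact: (represents_qline (nz1 F)).
rewrite -[X in represents _ X]mulr1; apply: represents_qtens IHs.
exact/represents_qsuml/(represents_qline (nz1 F)).
Qed.

Lemma torsion_formMn phi k : torsion_form phi -> torsion_form (qmuln k phi).
Proof.
by case=> m m_gt0 phim; exists m => //; rewrite witt_classMn -mulrnA mulnC mulrnA phim mul0rn.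
Qed.

Lemma torsion_form_class phi psi : witt_class phi = witt_class psi ->
  torsion_form phi -> torsion_form psi.
Proof. by rewrite /torsion_form => ->. Qed.

Lemma subform_qdim phi psi : subform phi psi -> (qdim phi <= qdim psi)%N.
Proof. by case=> chi /(isometric_qdim two_neq0) ->; exact: leq_addr. Qed.

Lemma similar_qdim phi psi : Defs.similar phi psi -> qdim phi = qdim psi.
Proof. by case=> c /(isometric_qdim two_neq0). Qed.

(** After the blocks are rescaled by [qmdiag_value], [c] is a sum of diagonal coefficients, so [<c>]
    splits off before multiplication by [2 ^ r]. *)
Lemma represents_qmuln_subform r s c : represents (qmuln (2 ^ r) (qdiag s)) (sval c) ->
  subform (qmuln (2 ^ r) (qline c)) (qmuln (2 ^ r) (qdiag s)).
Proof.
move=> /(isometric_represents (isometric_sym (qmdiagE _ _)))[v vE].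
have [s1 [s2 [_ iso sum_s1 _]]] := qmdiag_value F_real v.
have [t _ iso_t] := @qdiag_split_sum _ s1 c (etrans (esym sum_s1) vE).
exists (qsum (qmuln (2 ^ r) (qdiag t)) (qmdiag (2 ^ r) s2)).
apply: isometric_trans (isometric_sym (qmdiagE _ _)) _.
apply: isometric_trans iso _; apply: isometric_trans (isometric_sym (qsumA _ _ _)).
apply: isometric_qsum (isometric_refl _); apply: isometric_trans (qmdiagE _ _) _.
apply: isometric_trans (isometric_qmuln _ iso_t) _; exact: qmuln_qsum.
Qed.

Lemma anisotropic_torsion_qmuln r s : (0 < size s)%N ->
  torsion_form (qmuln (2 ^ r) (qdiag s)) -> (1 < size s)%N.
Proof.
case: s => [|a [|b s]] // _ tors; have [] := @qmuln_qline_not_torsion _ F_real (2 ^ r) a.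
  by rewrite expn_gt0.
apply: torsion_form_class tors; apply: isometric_witt_class.
by apply: isometric_qmuln; exact: qsumr0.
Qed.

Section Supreme.
Variables (pi : qform F) (n : nat).
Hypothesis pi_supreme : supreme_torsion_form pi.
Hypothesis pi_qdim : qdim pi = (2 ^ n)%N.

(** Used with [r = n], where the two bounds on [size t] clash, and with [r = n - 1], where they
    force [size t = 2]. *)
Lemma torsion_anisotropic_part r (x : witt F) : torsion_elt x -> x *+ 2 ^ r != 0 ->
  exists t, [/\ (1 < size t)%N, (2 ^ r * size t <= 2 ^ n)%N &
    exists2 chi, subform chi pi & Defs.similar (qmuln (2 ^ r) (qdiag t)) chi].
Proof.
elim/wittW: x => phi tors_phi nz.
have [s iso] := diagonalization phi two_neq0.
have [t [cls aniso]] := qmuln_qdiag_anisotropic_part F_real r s.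
have clsE : witt_class (qmuln (2 ^ r) (qdiag t)) = witt_class phi *+ 2 ^ r.
  by rewrite -cls !witt_classMn (isometric_witt_class iso).
have tors : torsion_form (qmuln (2 ^ r) (qdiag t)).
  by rewrite /torsion_form clsE -witt_classMn; exact: torsion_formMn.
have [_ _ /(_ _ aniso tors)[chi sub sim]] := pi_supreme.
exists t; split; last by exists chi.
  apply: anisotropic_torsion_qmuln tors; rewrite lt0n; apply: contraNneq nz => /size0nil t0.
  by rewrite -clsE t0 witt_classMn witt_class0 mul0rn.
by have := subform_qdim sub; rewrite -(similar_qdim sim) pi_qdim qdim_qmuln qdim_qdiag.
Qed.

Lemma kills_torsion_supreme : kills_torsion (witt F) (2 ^ n).
Proof.
split; first by rewrite expn_gt0.
move=> x tors; apply/eqP/negPn/negP => /(torsion_anisotropic_part tors)[t [size_t le_n _]].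
by move: le_n; rewrite leqNgt -{1}[(2 ^ n)%N]muln1 ltn_pmul2l ?size_t // expn_gt0.
Qed.

Lemma subform_of_not_kills_torsion r : n = r.+1 -> represents pi 1 ->
  ~ kills_torsion (witt F) (2 ^ r) -> subform (qmuln (2 ^ r) (qline (nz1 F))) pi.
Proof.
move=> nE pi1 not_kill.
have [x [tors nz]] : exists x : witt F, torsion_elt x /\ x *+ 2 ^ r != 0.
  apply: contra_notP not_kill => /forallNP no_x; split; first by rewrite expn_gt0.
  move=> x tors; apply/eqP/negPn/negP => nz; exact: (no_x x).
have [t [size_t le_n [chi [chi' iso] sim]]] := torsion_anisotropic_part tors nz.
have dim_chi' : qdim chi' = 0%N.
  have := isometric_qdim two_neq0 iso; have := similar_qdim sim.
  rewrite pi_qdim qdim_qmuln qdim_qdiag /= nE expnS.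
  have : (2 ^ r * 2 <= 2 ^ r * size t)%N by rewrite leq_mul2l size_t orbT.
  by lia.
have {}iso : isometric pi chi.
  apply: isometric_trans iso _; apply: isometric_trans (qsumr0 _).
  by apply: isometric_qsum (isometric_qzero dim_chi'); exact: isometric_refl.
case: sim => c iso_c.
(* As [pi] represents 1, [c pi] represents [c] and so contains [2 ^ r x <c>]; scaling by [c] once
   more turns this into [2 ^ r x <1>] inside [pi]. *)
have [|psi iso_psi] := @represents_qmuln_subform r t c.
  apply: isometric_represents (isometric_sym iso_c) _.
  have [v v1] := isometric_represents iso pi1; exists v.
  by rewrite /qval /= -scalemxAr -scalemxAl mxE; move: v1; rewrite /qval => ->; rewrite mulr1.
exists (qscale c psi).
apply: isometric_trans iso _.
apply: isometric_trans (isometric_sym (qscale_involutive c _)) _.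
apply: isometric_trans (isometric_qscale c (isometric_sym iso_c)) _.
apply: isometric_trans (isometric_qscale c iso_psi) _.
apply: isometric_trans (qscale_qsum _ _ _) _.
apply: isometric_qsum (isometric_refl _).
apply: isometric_trans (qscale_qmuln _ _ _) _; apply: isometric_qmuln.
apply: isometric_trans (qscale_qline (b := nzM c c) erefl) _.
by apply: (@qline_mul_sqr _ _ _ (sval c)); rewrite /= mul1r expr2.
Qed.

End Supreme.

(** Padding with zeros makes [- d] a sum of [2 ^ N] squares, so [2 ^ N x <1>] and [2 ^ N x <-d>] are
    isometric and [2 ^ N] kills [<1, d>]. *)
Lemma torsion_form_qline_sum d N (x : 'rV[F]_N) : - sval d = sqnorm x ->
  torsion_form (qsum (qline (nz1 F)) (qline d)).
Proof.
move=> dE; exists (2 ^ N)%N; first by rewrite expn_gt0.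
have N_le : (N <= 2 ^ N)%N by rewrite ltnW // ltn_expl.
have [y yE] : exists y : 'rV_(2 ^ N), sqnorm y = sqnorm x.
  rewrite -(subnKC N_le); exists (row_mx x 0).
  by rewrite sqnorm_row_mx /sqnorm mul0mx [X in _ + X]mxE addr0.
rewrite witt_classD mulrnDl -!witt_classMn.
rewrite (isometric_witt_class (@qmuln_qline_nzM _ N (nz1 F) (nzN d) y _)) ?yE //.
rewrite !witt_classMn -mulrnDl.
suff -> : nzM (nz1 F) (nzN d) = nzN d by rewrite addrC witt_class_qline_nzN // mul0rn.
by apply: val_inj; rewrite /= mul1r.
Qed.

Lemma not_kills_torsion_of_subform pi r : anisotropic pi -> torsion_form pi ->
  qdim pi = (2 ^ r.+1)%N -> subform (qmuln (2 ^ r) (qline (nz1 F))) pi ->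
  ~ kills_torsion (witt F) (2 ^ r).
Proof.
set sigma := qmuln _ _ => aniso [m m_gt0 pim0] dim_pi [chi iso] [_ kill].
have two_r_gt0 : (0 < 2 ^ r)%N by rewrite expn_gt0.
have dim_chi : qdim chi = (2 ^ r)%N.
  have := isometric_qdim two_neq0 iso.
  by rewrite dim_pi /= qdim_qmuln muln1 expnS; lia.
have [v qv] : exists v : 'rV_(qdim chi), qval v != 0.
  by apply: exists_qval_neq0; rewrite ?dim_chi.
pose d : nonzero F := exist (fun x : F => x != 0) (qval v) qv.
have chi_d : represents chi (sval d) by exists v.
have sigma_aniso : anisotropic sigma := @qmuln_qline_anisotropic _ F_real _ _.
have tors : torsion_form (qsum (qline (nz1 F)) (qline d)).
  (* Since [m pi] has trivial class, the anisotropic form [m sigma] represents [- d], which is thus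
     a sum of squares. *)
  have [||||u uE] := @represents_opp _ two_neq0 (qmuln m sigma) (qmuln m chi) (sval d).
  - apply: isometric_anisotropic (isometric_sym (qmuln_qmuln _ _ _)) _.
    exact: qmuln_qline_anisotropic.
  - by rewrite !qdim_qmuln dim_chi muln1.
  - rewrite witt_classD !witt_classMn -mulrnDl -witt_classMn -witt_classD.
    by rewrite -(isometric_witt_class iso).
  - exact: represents_qmuln.
  have iso_scalar : isometric (qmuln m sigma) (qscalar (m * 2 ^ r) (nz1 F)).
    exact: isometric_trans (qmuln_qmuln m _ _) (qmuln_qline _ _).
  have [y] := isometric_represents iso_scalar (ex_intro _ u uE).
  by rewrite qval_qscalar mul1r => yE; apply: (@torsion_form_qline_sum d _ y).
(* If [2 ^ r] killed [<1, d>], [sigma] would take the value [- d] at some [u], making [(u, v)]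
   isotropic for [pi]. *)
have [||||u uE] := @represents_opp _ two_neq0 sigma (qmuln (2 ^ r) (qline d)) (sval d) => //.
- by rewrite !qdim_qmuln.
- by rewrite -(isometric_witt_class (qmuln_qsum _ _ _)) witt_classMn kill.
- exact/represents_qmuln/represents_qline.
have := isometric_anisotropic iso aniso.
move=> /(_ (row_mx u v : 'rV_(qdim sigma + qdim chi))).
rewrite qval_qsum row_mxKl row_mxKr uE addNr => /(_ erefl).
rewrite -[RHS]row_mx0 => /eq_row_mx[_ v0].
by have := qv; rewrite v0 qval0 eqxx.
Qed.

End SupremeTorsionForms.

Theorem theorem5p5 (F : fieldType) (n : nat) (pi : qform F)
  (F_real : formally_real F) (F_nonpyth : ~ pythagorean F)
  (pi_supreme : supreme_torsion_form pi) (pi_pfister : pfister n pi) :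
  (exists2 h : nat, height F = Some h & (h <= 2 ^ n)%N) /\
  (height F = Some (2 ^ n)%N <->
     subform (qmuln (2 ^ n.-1) (qline (nz1 F))) pi).
Proof.
have two_neq0 := formally_real_two_neq0 F_real.
have [s iso] := pi_pfister.
have pi_qdim : qdim pi = (2 ^ n)%N.
  by rewrite (isometric_qdim two_neq0 iso) qdim_qpfister size_tuple.
have pi1 : represents pi 1.
  exact: isometric_represents (isometric_sym iso) (qpfister_represents1 _).
have kill := kills_torsion_supreme F_real pi_supreme pi_qdim.
have [h [hE kill_h min_h]] := torsion_exponentP kill.
have two_n_gt0 : (0 < 2 ^ n)%N by rewrite expn_gt0.
split; first by exists h => //; apply: dvdn_leq => //; exact: min_h.
have [pi_aniso pi_tors _] := pi_supreme.
(* For [n = 0], [pi] would be [<1>], which is not torsion; so [n.-1] is a true predecessor. *)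
have [r nE] : exists r, n = r.+1.
  case: n s iso {kill min_h two_n_gt0 pi_pfister pi_qdim} => [|r] s iso; last by exists r.
  have [] := @qmuln_qline_not_torsion _ F_real 1 (nz1 F) isT.
  apply: torsion_form_class pi_tors; apply: isometric_witt_class.
  by rewrite (tuple0 s) in iso; apply: isometric_trans iso (isometric_sym (qsumr0 _)).
rewrite /height hE nE /=; split=> [[hE2]|sub].
  apply: (subform_of_not_kills_torsion F_real pi_supreme pi_qdim nE pi1) => /min_h.
  by rewrite hE2 dvdn_Pexp2l // ltnn.
(* The height is [2 ^ m] with [m <= n]; if [m <= r], then [2 ^ r] would kill the torsion as well. *)
have /(dvdn_pfactor _ _ (isT : prime 2))[m le_mn hE2] := min_h _ kill.
rewrite hE2; suff -> : m = r.+1 by [].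
have [lt_mr|] := ltnP m r.+1; last by lia.
have [] := not_kills_torsion_of_subform F_real pi_aniso pi_tors _ sub; first by rewrite -nE.
apply: kills_torsion_dvdn kill_h _ _; rewrite ?expn_gt0 // hE2.
by rewrite dvdn_exp2l.
Qed.
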